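(* There exists a symplectic magnetic system $(S^2,g,\sigma)$ that has an energy level not of contact type; that is, there are a Riemannian metric $g$ and a symplectic form $\sigma$ on $S^2$ and some $m>0$ such that $\Sigma_m$ is not of contact type.
   Context: On $\pi:TS^2\to S^2$ put $\lambda_{(x,v)}(\xi)=g_x(v,d\pi\,\xi)$, $\omega_\sigma=d\lambda-\pi^*\sigma$, $E(x,v)=\frac12g_x(v,v)$, $\Sigma_m=\{E=m^2/2\}$. $\Sigma_m$ is of contact type if $\omega_\sigma|_{\Sigma_m}$ has a primitive which is a contact form. *)

(* Defs.v *)
From HB Require Import structures.
From mathcomp Require Import all_boot all_order all_algebra.
From mathcomp Require Import all_classical all_reals all_analysis.

Set Implicit Arguments.
Unset Strict Implicit.
Unset Printing Implicit Defensive.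

Import Order.TTheory GRing.Theory Num.Theory.
Import numFieldNormedType.Exports.

Local Open Scope classical_set_scope.
Local Open Scope ring_scope.

(* Manifolds are closed embedded submanifolds [M : set V] of a
   finite-dimensional normed space [V].  A smooth tensor field on such an [M]
   is the same thing as the restriction to the tangent spaces of [M] of a
   smooth tensor field on [V]; tensor fields are therefore given on [V], and
   all conditions on them other than multilinearity (and, for forms,
   alternation) and smoothness only concern points of [M] and vectors tangent
   to [M].  Restriction commutes with the exterior derivative, so the values
   of [ext_d1] and [ext_d2] on vectors tangent to [M] at points of [M] depend
   only on the restricted form. *)

Section Forms.
Context {R : realType}.

Fixpoint Ck {V W : normedModType R} (k : nat) (f : V -> W) : Prop :=
  match k with
  | 0 => continuous f
  | k'.+1 => (forall p, differentiable f p) /\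
             forall v, Ck k' (fun p => 'D_v f p)
  end.

Definition smooth {V W : normedModType R} (f : V -> W) : Prop :=
  forall k, Ck k f.

Context {V : normedModType R}.

(* Tangent vectors are the velocities of smooth curves contained in [M].  A
   curve defined on an interval around 0 can be reparametrised to all of [R]
   without changing its velocity at 0. *)
Definition tangent (M : set V) (p : V) : set V :=
  [set u | exists c : R -> V,
     [/\ smooth c, forall t, M (c t), c 0 = p & derive1 c 0 = u]].

Definition tangent_bundle (M : set V) : set (V * V) :=
  [set p | M p.1 /\ tangent M p.1 p.2].

Definition one_form (a : V -> V -> R) : Prop :=
  (forall p, scalar (a p)) /\ (forall u, smooth (fun p => a p u)).

Definition two_tensor (b : V -> V -> V -> R) : Prop :=
  [/\ forall p u, scalar (b p u),
      forall p v, scalar (fun u => b p u v)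
    & forall u v, smooth (fun p => b p u v)].

Definition two_form (w : V -> V -> V -> R) : Prop :=
  two_tensor w /\ (forall p u, w p u u = 0).

(* Exterior derivatives, evaluated on constant vector fields. *)
Definition ext_d1 (a : V -> V -> R) (p u v : V) : R :=
  'D_u (fun q => a q v) p - 'D_v (fun q => a q u) p.

Definition ext_d2 (w : V -> V -> V -> R) (p u1 u2 u3 : V) : R :=
  'D_u1 (fun q => w q u2 u3) p - 'D_u2 (fun q => w q u1 u3) p
  + 'D_u3 (fun q => w q u1 u2) p.

Definition wedge12 (a : V -> V -> R) (w : V -> V -> V -> R)
    (p u1 u2 u3 : V) : R :=
  a p u1 * w p u2 u3 - a p u2 * w p u1 u3 + a p u3 * w p u1 u2.

Definition riemannian_metric (M : set V) (g : V -> V -> V -> R) : Prop :=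
  two_tensor g /\
  forall p, M p ->
    (forall u v, tangent M p u -> tangent M p v -> g p u v = g p v u) /\
    (forall u, tangent M p u -> u != 0 -> 0 < g p u u).

Definition closed_two_form (M : set V) (w : V -> V -> V -> R) : Prop :=
  two_form w /\
  forall p u1 u2 u3, M p ->
    tangent M p u1 -> tangent M p u2 -> tangent M p u3 ->
    ext_d2 w p u1 u2 u3 = 0.

Definition symplectic_form (M : set V) (w : V -> V -> V -> R) : Prop :=
  closed_two_form M w /\
  forall p u, M p -> tangent M p u -> u != 0 ->
    exists2 v, tangent M p v & w p u v != 0.

Definition is_primitive_on (M : set V) (a : V -> V -> R)
    (w : V -> V -> V -> R) : Prop :=
  forall p u v, M p -> tangent M p u -> tangent M p v ->
    ext_d1 a p u v = w p u v.

(* Contact forms on a 3-dimensional [M]. *)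
Definition contact_form3 (M : set V) (a : V -> V -> R) : Prop :=
  one_form a /\
  forall p, M p -> exists u1 u2 u3,
    [/\ tangent M p u1, tangent M p u2, tangent M p u3
      & wedge12 a (ext_d1 a) p u1 u2 u3 != 0].

End Forms.

Definition pullback2 {R : realType} {V W : normedModType R} (f : V -> W)
    (w : W -> W -> W -> R) (p u v : V) : R :=
  w (f p) ('d f p u) ('d f p v).

Section Magnetic.
Context {R : realType}.

Definition sphere2 : set 'rV[R]_3 := [set x | \sum_i x 0 i ^+ 2 = 1].

(* The bundle projection TS^2 -> S^2, extended to R^3 x R^3. *)
Definition bundle_proj (p : 'rV[R]_3 * 'rV[R]_3) : 'rV[R]_3 := p.1.

Implicit Types (g s : 'rV[R]_3 -> 'rV[R]_3 -> 'rV[R]_3 -> R) (m : R).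

Definition lambda g (p xi : 'rV[R]_3 * 'rV[R]_3) : R :=
  g p.1 p.2 ('d bundle_proj p xi).

Definition omega g s (p xi eta : 'rV[R]_3 * 'rV[R]_3) : R :=
  ext_d1 (lambda g) p xi eta - pullback2 bundle_proj s p xi eta.

Definition energy g (p : 'rV[R]_3 * 'rV[R]_3) : R := 2^-1 * g p.1 p.2 p.2.

Definition energy_level g m : set ('rV[R]_3 * 'rV[R]_3) :=
  [set p | tangent_bundle sphere2 p /\ energy g p = m ^+ 2 / 2].

Definition contact_type g s m : Prop :=
  exists a : 'rV[R]_3 * 'rV[R]_3 -> 'rV[R]_3 * 'rV[R]_3 -> R,
    is_primitive_on (energy_level g m) a (omega g s) /\
    contact_form3 (energy_level g m) a.

Definition symplectic_magnetic_system g s : Prop :=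
  riemannian_metric sphere2 g /\ symplectic_form sphere2 s.

End Magnetic.

(* Main.v *)
(* Take the round metric and [s = f(z) * area], with [f > 0] a function of the
   height [z], and let [X] be the magnetic vector field on the unit tangent
   bundle; it spans the kernel of [omega].  If [a] is a contact form with
   [da = omega] then [a X] vanishes nowhere, so it suffices to find a closed
   orbit of [X] over which [a] integrates to 0.

   The rotations about the vertical axis preserve [omega] and have momentum map
   [J(x, v) = v . (e_3 * x) + h(z)] with [h' = f].  By Stokes' formula, the
   integral of [a] over the rotation orbit of [(x, v)] is [2 pi (J - k)] for a
   constant [k].  Over the two poles these orbits are the fibres, traversed in
   opposite directions, and fibres over different points have the same integral
   by Stokes again; hence [k = (h(1) + h(-1)) / 2].  A parallel of height [z]
   and radius [r] is a magnetic geodesic of unit speed iff [f(z) = z / r], and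
   its lift has [J = r + h(z)].  So one needs a positive [f] with
   [f(z) = z / r] and [2 (r + h(z)) = h(1) + h(-1)] for some [z]; for
   [z = 3 / 5] such an [f] is found in the form [b + c (z^6 + z^7)]. *)
From HB Require Import structures.
Require Import Defs.
From mathcomp Require Import all_boot all_order all_algebra.
From mathcomp Require Import all_classical all_reals all_analysis.
From mathcomp Require Import ring lra.

Set Implicit Arguments.
Unset Strict Implicit.
Unset Printing Implicit Defensive.

Import Order.TTheory GRing.Theory Num.Theory.
Import numFieldNormedType.Exports.

Local Open Scope classical_set_scope.
Local Open Scope ring_scope.

(** * Closure properties of the classes [Ck] *)

Section Smoothness.
Context {R : realType}.
Implicit Types V W : normedModType R.

Lemma Ck_le {V W} (f : V -> W) k : Ck k.+1 f -> Ck k f.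
Proof.
elim: k f => [f [df _] p|k IH f [df Df]].
  exact: differentiable_continuous.
by split => // v; apply/IH/Df.
Qed.

Lemma Ck_cst {V W} (w : W) k : Ck k (fun _ : V => w).
Proof.
elim: k w => [w p|k IH w]; first exact: cvg_cst.
split=> [p|v]; first exact: differentiable_cst.
by under [X in Ck k X]eq_fun do rewrite derive_cst.
Qed.

Lemma CkD {V W} (f g : V -> W) k :
  Ck k f -> Ck k g -> Ck k (fun p => f p + g p).
Proof.
elim: k f g => [f g cf cg p|k IH f g [df Df] [dg Dg]].
  by apply: cvgD; [exact: cf|exact: cg].
split=> [p|v]; first exact: differentiableD.
have -> : (fun p => 'D_v (fun p => f p + g p) p) =
    (fun p => 'D_v f p + 'D_v g p).
  by apply/funext => p; rewrite deriveD//; exact: diff_derivable.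
by apply: IH; [exact: Df|exact: Dg].
Qed.

Lemma CkM {V} (f g : V -> R) k : Ck k f -> Ck k g -> Ck k (fun p => f p * g p).
Proof.
elim: k f g => [f g cf cg p|k IH f g Cf Cg].
  by apply: cvgM; [exact: cf|exact: cg].
have [[df Df] [dg Dg]] := (Cf, Cg).
split=> [p|v]; first exact: differentiableM.
have -> : (fun p => 'D_v (fun p => f p * g p) p) =
    (fun p => f p * 'D_v g p + g p * 'D_v f p).
  by apply/funext => p; rewrite deriveM//; exact: diff_derivable.
(* The Leibniz rule keeps one factor undifferentiated, so [Ck_le] lowers its order before the
   induction hypothesis applies. *)
by apply: CkD; apply: IH; [exact: Ck_le|exact: Dg|exact: Ck_le|exact: Df].
Qed.

Lemma CkX {V} (f : V -> R) k n : Ck k f -> Ck k (fun p => f p ^+ n).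
Proof.
move=> Cf; elim: n => [|n IH].
  by under [X in Ck k X]eq_fun do rewrite expr0; exact: Ck_cst.
by under [X in Ck k X]eq_fun do rewrite exprS; exact: CkM.
Qed.

Lemma derive_coord {n} (i : 'I_n) (p v : 'rV[R]_n) :
  'D_v (fun q : 'rV[R]_n => q 0 i) p = v 0 i.
Proof.
have /(congr1 (fun m : 'rV[R]_n => m 0 i)) := derive_id p v.
by rewrite derive_mx ?mxE//; exact: derivable_id.
Qed.

Lemma Ck_coord {n} (i : 'I_n) k : Ck k (fun q : 'rV[R]_n => q 0 i).
Proof.
case: k => [|k]; first exact: coord_continuous.
split=> [p|v]; first exact: differentiable_coord.
have -> : (fun p => 'D_v (fun q : 'rV[R]_n => q 0 i) p) = (fun=> v 0 i).
  by apply/funext => p; rewrite derive_coord.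
exact: Ck_cst.
Qed.

End Smoothness.

(** * Chain rule along curves, finite sums and frames *)

Section Calculus.
Context {R : realType} {V W : normedModType R}.

Lemma is_derive_comp_curve (f : V -> W) (c : R -> V) (t : R) (u : V) :
  differentiable f (c t) -> is_derive t 1 c u ->
  is_derive t 1 (f \o c) ('D_u f (c t)).
Proof.
move=> df [dc <-]; have dc' : differentiable c t by exact/derivable1_diffP.
have dfc : differentiable (f \o c) t by exact: differentiable_comp.
apply: DeriveDef; first exact: diff_derivable.
by rewrite deriveE// diff_comp//= -!deriveE.
Qed.

Lemma is_derive_comp_linear (f : {linear V -> W}) (c : R -> V) (t : R) (u : V) :
  continuous f -> is_derive t 1 c u -> is_derive t 1 (f \o c) (f u).
Proof.
move=> cf dc; have df : differentiable f (c t) by exact: linear_differentiable.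
have := is_derive_comp_curve df dc.
by rewrite deriveE// diff_lin.
Qed.

End Calculus.

Lemma continuous_sum {R : realType} {T : topologicalType} {I : Type}
    (r : seq I) (f : I -> T -> R) :
  (forall i, continuous (f i)) -> continuous (fun x => \sum_(i <- r) f i x).
Proof.
move=> cf x; elim: r => [|i r IH].
  by under eq_fun do rewrite big_nil; rewrite /= ?big_nil; exact: cvg_cst.
under eq_fun do rewrite big_cons; rewrite /= ?big_cons.
exact: cvgD (cf i x) IH.
Qed.

(** [one_form] asks for smoothness in the base point with the vector fixed. A finite frame with
    continuous coordinates turns this into joint regularity in the point and the vector. *)
Definition is_frame {R : realType} {V : normedModType R} {n : nat}
    (e : 'I_n -> V) (co : 'I_n -> {linear V -> R^o}) :=
  (forall i, continuous (co i)) /\ (forall u, u = \sum_i co i u *: e i).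

(** * One-forms evaluated along curves *)

Section OneForms.
Context {R : realType} {V : normedModType R} {n : nat}.
Context (e : 'I_n -> V) (co : 'I_n -> {linear V -> R^o}).
Context (e_frame : is_frame e co).
Let co_continuous i : continuous (co i). Proof. exact: e_frame.1. Qed.
Let co_sum u : u = \sum_i co i u *: e i. Proof. exact: e_frame.2. Qed.
Context (a : V -> V -> R) (a_form : one_form a).

Lemma one_form_sum p u : a p u = \sum_i co i u * a p (e i).
Proof.
rewrite {1}[u]co_sum; elim/big_rec2: _ => [|i x y _ <-].
  by have := a_form.1 p 1 0 0; rewrite scaler0 addr0 mul1r => ha; lra.
exact: a_form.1.
Qed.

Lemma differentiable_one_form u p : differentiable (a^~ u) p.
Proof. exact: (a_form.2 u 1%N).1. Qed.

Lemma derive_one_form_dir p u v :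
  'D_v (a^~ u) p = \sum_j co j v * 'D_(e j) (a^~ u) p.
Proof.
rewrite deriveE; last exact: differentiable_one_form.
rewrite {1}[v]co_sum linear_sum; apply: eq_bigr => j _.
by rewrite linearZ deriveE//; exact: differentiable_one_form.
Qed.

Lemma derive_one_form_sum p u v :
  'D_v (a^~ u) p = \sum_i \sum_j co i u * (co j v * 'D_(e j) (a^~ (e i)) p).
Proof.
have -> : a^~ u = \sum_i (co i u *: a^~ (e i)).
  by apply/funext => q; rewrite one_form_sum fct_sumE.
rewrite derive_sum; last first.
  move=> i; apply: derivableZ; apply: diff_derivable.
  exact: differentiable_one_form.
apply: eq_bigr => i _; rewrite deriveZ; last first.
  by apply: diff_derivable; exact: differentiable_one_form.
by rewrite -mulr_sumr derive_one_form_dir.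
Qed.

(** Product rule on the frame expansion: the base point moves in the first term, the linear argument
    in the second. *)
Lemma is_derive_one_form (c u : R -> V) (t : R) (c' u' : V) :
  is_derive t (1 : R) c c' -> is_derive t (1 : R) u u' ->
  is_derive t (1 : R) (fun t => a (c t) (u t))
    ('D_c' (a^~ (u t)) (c t) + a (c t) u').
Proof.
move=> dc du.
have -> : (fun t => a (c t) (u t)) =
    \sum_i ((co i \o u) * (a^~ (e i) \o c)).
  by apply/funext => q; rewrite one_form_sum fct_sumE.
apply: is_derive_eq.
  apply: is_derive_sum => i; apply: is_deriveM.
    exact: is_derive_comp_linear.
  by apply: is_derive_comp_curve => //; exact: differentiable_one_form.
rewrite [a (c t) u']one_form_sum derive_one_form_sum -big_split/=.
apply: eq_bigr => i _.
by rewrite /= -mulr_sumr -derive_one_form_dir [_ *: co i u']mulrC.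
Qed.

Context {T : topologicalType} (c u v : T -> V).
Context (cc : continuous c) (cu : continuous u) (cv : continuous v).

Lemma continuous_one_form : continuous (fun x => a (c x) (u x)).
Proof.
have -> : (fun x => a (c x) (u x)) =
    (fun x => \sum_i co i (u x) * a (c x) (e i)).
  by apply/funext => q; rewrite one_form_sum.
apply: continuous_sum => i x; apply: cvgM.
  by apply: (continuous_comp (f := u) (g := co i));
    [exact: cu|exact: co_continuous].
have ca : continuous (a^~ (e i)) by have := a_form.2 (e i) 0%N.
by apply: (continuous_comp (f := c) (g := a^~ (e i))); [exact: cc|exact: ca].
Qed.

Lemma continuous_derive_one_form :
  continuous (fun x => 'D_(v x) (a^~ (u x)) (c x)).
Proof.
have -> : (fun x => 'D_(v x) (a^~ (u x)) (c x)) = (fun x =>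
    \sum_i \sum_j co i (u x) * (co j (v x) * 'D_(e j) (a^~ (e i)) (c x))).
  by apply/funext => q; rewrite derive_one_form_sum.
apply: continuous_sum => i; apply: continuous_sum => j x; apply: cvgM.
  by apply: (continuous_comp (f := u) (g := co i));
    [exact: cu|exact: co_continuous].
apply: cvgM.
  by apply: (continuous_comp (f := v) (g := co j));
    [exact: cv|exact: co_continuous].
have ca : continuous ('D_(e j) (a^~ (e i))) := (a_form.2 (e i) 1%N).2 (e j).
by apply: (continuous_comp (f := c) (g := 'D_(e j) (a^~ (e i))));
  [exact: cc|exact: ca].
Qed.

End OneForms.

(** * Integrals over a period, with and without a parameter *)

Section CircleIntegral.
Context {R : realType} (T : R) (T_gt0 : 0 < T).
Local Notation mu := (@lebesgue_measure R).
Implicit Types f g : R -> R.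

Lemma continuous_integrable_itv f :
  continuous f -> mu.-integrable `[0, T] (EFin \o f).
Proof.
move=> cf; apply: continuous_compact_integrable; first exact: segment_compact.
exact: continuous_subspaceT.
Qed.

Lemma Rintegral_derive f g :
  (forall t, is_derive t (1 : R) f (g t)) -> continuous g ->
  \int[mu]_(t in `[0, T]) g t = f T - f 0.
Proof.
move=> df cg.
have cf : continuous f.
  move=> t; apply/differentiable_continuous/derivable1_diffP.
  exact: (@ex_derive _ _ _ _ _ _ _ (df t)).
rewrite /Rintegral (@continuous_FTC2 _ g f)//.
- exact: continuous_subspaceT.
- split=> [t _||].
  + exact: (@ex_derive _ _ _ _ _ _ _ (df t)).
  + exact/cvg_at_right_filter/cf.
  + exact/cvg_at_left_filter/cf.
- by move=> t _; rewrite derive1E derive_val.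
Qed.

(** Rolle's theorem for the antiderivative [F], which vanishes at both ends. *)
Lemma Rintegral_eq0_root f : continuous f ->
  \int[mu]_(t in `[0, T]) f t = 0 -> exists t, f t = 0.
Proof.
move=> cf f0; pose F x := \int[mu]_(t in `[0, x]) f t.
have dF x : 0 < x < T -> derivable F x 1 /\ derive1 F x = f x.
  move=> /andP[x0 xT]; apply: (@continuous_FTC1_closed _ _ _ _ T) => //.
    exact: continuous_integrable_itv.
  exact: cf.
have [|||c cT dc] := @Rolle R F 0 T T_gt0.
- by move=> x; rewrite in_itv/= => /dF[].
- apply: parameterized_integral_continuous; first exact: ltW.
  exact: continuous_integrable_itv.
- by rewrite /F f0 set_itv1 Rintegral_set1.
exists c; move: cT; rewrite in_itv/= => /dF[_ <-].
by rewrite derive1E derive_val.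
Qed.

(** Differentiation under the integral sign, dominated by a constant: [g] is continuous, hence
    bounded on the compact rectangle [K]. *)
Lemma is_derive_Rintegral (f g : R -> R -> R) s :
  (forall s t, is_derive s (1 : R) (f^~ t) (g s t)) ->
  (forall s, continuous (f s)) -> continuous (fun p : R * R => g p.1 p.2) ->
  is_derive s (1 : R) (fun s => \int[mu]_(t in `[0, T]) f s t)
    (\int[mu]_(t in `[0, T]) g s t).
Proof.
move=> df cf cg.
pose K := `[s - 1, s + 1]%classic `*` `[0, T]%classic.
have /compact_bounded[M [_ MK]] : compact ((fun p : R * R => g p.1 p.2) @` K).
  apply: continuous_compact; first exact: continuous_subspaceT.
  by apply: compact_setX; exact: segment_compact.
have dfE x y : partial1of2 f x y = g x y.
  by rewrite partial1of2E derive_val.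
have sI : `]s - 1, s + 1[%classic s by rewrite /= in_itv/=; lra.
have intf x : `]s - 1, s + 1[%classic x -> mu.-integrable `[0, T] (EFin \o f x).
  by move=> _; exact: continuous_integrable_itv.
have dfI x y : `]s - 1, s + 1[%classic x -> `[0, T]%classic y ->
    derivable (f^~ y) x 1.
  by move=> _ _; exact: (@ex_derive _ _ _ _ _ _ _ (df x y)).
(* Every real above [M] is a bound, but [M] itself may be negative; hence [|M| + 1]. *)
have intG : mu.-integrable `[0, T] (EFin \o (fun=> `|M| + 1)).
  by apply: continuous_integrable_itv => ?; exact: cvg_cst.
have gM x y : `]s - 1, s + 1[%classic x -> `[0, T]%classic y ->
    `|partial1of2 f x y| <= `|M| + 1.
  rewrite dfE /= in_itv/= => xI yT.
  apply: (MK (`|M| + 1)); first by rewrite (le_lt_trans (ler_norm M)) ?ltrDl.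
  exists (x, y) => //; split => //=; rewrite in_itv/=.
  by case/andP: xI => *; rewrite !ltW.
have G0 (y : R) : 0 <= `|M| + 1 by rewrite addr_ge0.
apply: DeriveDef.
  exact: (derivable_under_integral _ sI intf dfI G0 intG gM).
rewrite -derive1E (differentiation_under_integral _ sI intf dfI G0 intG gM)//.
by apply: eq_Rintegral => t _; rewrite dfE.
Qed.

End CircleIntegral.

(** * Stokes' formula for a family of loops *)

Section Stokes.
Context {R : realType} {V : normedModType R} {n : nat}.
Context (e : 'I_n -> V) (co : 'I_n -> {linear V -> R^o}).
Context (e_frame : is_frame e co).
Context (a : V -> V -> R) (a_form : one_form a).
Context (z zs zt zst : R -> R -> V) (T : R).
Local Notation mu := (@lebesgue_measure R).

(* The pullback of [da] is [d/ds (a z_t) - d/dt (a z_s)], and the second term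
   integrates to 0 over a loop. *)
Lemma is_derive_loop_integral s : 0 < T ->
  (forall s t, is_derive s (1 : R) (z^~ t) (zs s t)) ->
  (forall s t, is_derive t (1 : R) (z s) (zt s t)) ->
  (forall s t, is_derive s (1 : R) (zt^~ t) (zst s t)) ->
  (forall s t, is_derive t (1 : R) (zs s) (zst s t)) ->
  continuous (fun p : R * R => z p.1 p.2) ->
  continuous (fun p : R * R => zs p.1 p.2) ->
  continuous (fun p : R * R => zt p.1 p.2) ->
  continuous (fun p : R * R => zst p.1 p.2) ->
  z s T = z s 0 -> zs s T = zs s 0 ->
  is_derive s (1 : R) (fun s => \int[mu]_(t in `[0, T]) a (z s t) (zt s t))
    (\int[mu]_(t in `[0, T]) ext_d1 a (z s t) (zs s t) (zt s t)).
Proof.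
move=> T0 dzs dzt dzts dzst cz czs czt czst zT zsT.
have slice (U : topologicalType) (f : R -> R -> U) x :
    continuous (fun p : R * R => f p.1 p.2) -> continuous (f x).
  move=> cf y; apply: (continuous_comp (f := pair x)
    (g := fun p : R * R => f p.1 p.2)); last exact: cf.
  exact: (@cvg_pair _ _ _ _ (nbhs x) (nbhs y) _ _ _ (fun=> x) id
    (@cvg_cst _ _ _ _ _) (@cvg_id _ _)).
apply: is_derive_eq.
  apply: is_derive_Rintegral => //.
  - by move=> r t; exact: (is_derive_one_form e_frame).
  - by move=> r; apply: (continuous_one_form e_frame) => //; exact: slice.
  - move=> p; apply: cvgD.
      exact: (continuous_derive_one_form e_frame a_form cz czt czs).
    exact: (continuous_one_form e_frame a_form cz czst).
have dH t : is_derive t (1 : R) (fun t => a (z s t) (zs s t))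
    ('D_(zt s t) (a^~ (zs s t)) (z s t) + a (z s t) (zst s t)).
  exact: (is_derive_one_form e_frame).
have cE : continuous (fun t => ext_d1 a (z s t) (zs s t) (zt s t)).
  move=> t; apply: cvgB; apply: (continuous_derive_one_form e_frame) => //;
    exact: slice.
have cH : continuous (fun t =>
    'D_(zt s t) (a^~ (zs s t)) (z s t) + a (z s t) (zst s t)).
  move=> t; apply: cvgD.
    by apply: (continuous_derive_one_form e_frame) => //; exact: slice.
  by apply: (continuous_one_form e_frame) => //; exact: slice.
rewrite -[RHS]addr0 -[X in _ + X](subrr (a (z s 0) (zs s 0))).
rewrite -{1}zT -{1}zsT -(Rintegral_derive T0 dH cH).
rewrite -RintegralD//; [|exact: continuous_integrable_itv..].
by apply: eq_Rintegral => t _; rewrite /ext_d1; ring.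
Qed.

End Stokes.

(** * Trigonometric curves of degree one *)

Section Trig.
Context {R : realType} {V : normedModType R}.

(** Derivatives and time shifts stay in this class, so smoothness is settled at once for the great
    circles and loops used below. *)
Definition trig (A B C : V) (t : R) : V := cos t *: A + sin t *: B + C.

Lemma is_derive_trig A B C (t : R) :
  is_derive t (1 : R) (trig A B C) (trig B (- A) 0 t).
Proof.
have dZ (f : R -> R) df (X : V) : is_derive t (1 : R) f df ->
    is_derive t (1 : R) (fun t => f t *: X) (df *: X).
  move=> [/derivable1_diffP Df <-].
  apply: DeriveDef; first exact/diff_derivable/differentiableZl.
  by rewrite !deriveE ?diffZl//; exact: differentiableZl.
have -> : trig A B C =
    (fun t => cos t *: A) + (fun t => sin t *: B) + cst C by [].
have dA := dZ _ _ A (is_derive_cos t).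
have dB := dZ _ _ B (is_derive_sin t).
have D := is_deriveD (is_deriveD dA dB) (is_derive_cst C t 1).
by apply: (is_derive_eq D); rewrite /trig scaleNr scalerN !addr0 addrC.
Qed.

Lemma smooth_trig A B C : smooth (trig A B C).
Proof.
move=> k; elim: k A B C => [|k IH] A B C.
  move=> t; apply/differentiable_continuous/derivable1_diffP.
  exact: (@ex_derive _ _ _ _ _ _ _ (is_derive_trig A B C t)).
have dtrig t : differentiable (trig A B C) t.
  apply/derivable1_diffP.
  exact: (@ex_derive _ _ _ _ _ _ _ (is_derive_trig A B C t)).
split=> [//|v].
have -> : (fun p => 'D_v (trig A B C) p) = trig (v *: B) (v *: - A) 0.
  apply/funext => t; rewrite deriveE//.
  have -> : 'd (trig A B C) t v = v *: 'd (trig A B C) t 1.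
    by rewrite -linearZ /= [_ *: 1]mulr1.
  rewrite -deriveE//.
  have -> := @derive_val _ _ _ _ _ _ _ (is_derive_trig A B C t).
  by rewrite /trig !addr0 scalerDr !scalerA ![v * _]mulrC.
exact: IH.
Qed.

(** [tangent] reads off a velocity at 0, so the curve is shifted by [s]; the addition formulas put
    the shifted curve in the form [trig] again. *)
Lemma tangent_trig (M : set V) (c : R -> V) (s : R) (A B C u : V) :
  (forall t, M (c t)) -> c = trig A B C -> u = trig B (- A) 0 s ->
  tangent M (c s) u.
Proof.
move=> Mc cE uE.
have csE : (fun t => c (s + t)) = trig (trig A B 0 s) (trig B (- A) 0 s) C.
  apply/funext => t; rewrite cE /trig cosD sinD !addr0; congr (_ + _).
  rewrite !scalerDr !scalerBl !scalerDl !scalerN !scalerA.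
  rewrite ![cos t * _]mulrC ![sin t * _]mulrC.
  rewrite -!addrA; congr (_ + _); rewrite addrCA; congr (_ + _).
  by rewrite addrC; congr (_ + _); rewrite addrC.
exists (fun t => c (s + t)); split=> //.
- by rewrite csE; exact: smooth_trig.
- by rewrite addr0.
- rewrite derive1E csE.
  have -> := @derive_val _ _ _ _ _ _ _ (is_derive_trig (trig A B 0 s)
    (trig B (- A) 0 s) C 0).
  by rewrite uE {1}/trig cos0 sin0 scale1r scale0r !addr0.
Qed.

End Trig.

(** * Vector algebra in [R^3] and tangent vectors of the sphere *)

Section Vectors.
Context {R : realType}.
Local Notation U := 'rV[R]_3.
Implicit Types u v w x : U.

Definition vec3 (a b c : R) : U := \row_i [:: a; b; c]`_i.

Definition dot u v : R := u 0 0 * v 0 0 + u 0 1 * v 0 1 + u 0 2 * v 0 2.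

Definition cross u v : U := vec3
  (u 0 1 * v 0 2 - u 0 2 * v 0 1)
  (u 0 2 * v 0 0 - u 0 0 * v 0 2)
  (u 0 0 * v 0 1 - u 0 1 * v 0 0).

(** At a point [x] of the unit sphere, [det3 x] restricts to the area form on the tangent plane. *)
Definition det3 u v w : R := dot u (cross v w).

Lemma row3_sum (f : 'I_3 -> R) : \sum_i f i = f 0 + f 1 + f 2.
Proof.
rewrite !big_ord_recl big_ord0 addr0 addrA.
by congr (_ + f _ + f _); apply: val_inj.
Qed.

Lemma row3P u v :
  u 0 0 = v 0 0 -> u 0 1 = v 0 1 -> u 0 2 = v 0 2 -> u = v.
Proof.
move=> h0 h1 h2; apply/rowP => -[[|[|[|//]]] i3].
- by have -> : Ordinal i3 = 0 by apply: val_inj.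
- by have -> : Ordinal i3 = 1 by apply: val_inj.
- by have -> : Ordinal i3 = 2 by apply: val_inj.
Qed.

Lemma vec3E a b c :
  (vec3 a b c 0 0 = a) * (vec3 a b c 0 1 = b) * (vec3 a b c 0 2 = c).
Proof. by rewrite !mxE. Qed.

Definition coordE := (vec3E, mxE).

Lemma vec3Z k a b c : k *: vec3 a b c = vec3 (k * a) (k * b) (k * c).
Proof. by apply: row3P; rewrite mxE !vec3E. Qed.

Lemma vec3D a b c a' b' c' :
  vec3 a b c + vec3 a' b' c' = vec3 (a + a') (b + b') (c + c').
Proof. by apply: row3P; rewrite mxE !vec3E. Qed.

Lemma vec3N a b c : - vec3 a b c = vec3 (- a) (- b) (- c).
Proof. by apply: row3P; rewrite mxE !vec3E. Qed.

Lemma vec30 : (0 : U) = vec3 0 0 0.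
Proof. by apply: row3P; rewrite mxE !vec3E. Qed.

Lemma dot_eq0 u : dot u u = 0 -> u = 0.
Proof.
rewrite /dot => u0.
have [h0 h1 h2] : [/\ u 0 0 = 0, u 0 1 = 0 & u 0 2 = 0].
  have := sqr_ge0 (u 0 0); have := sqr_ge0 (u 0 1); have := sqr_ge0 (u 0 2).
  by rewrite !expr2 => *; split; apply/eqP; rewrite -sqrf_eq0 expr2; apply/eqP;
    lra.
by apply: row3P; rewrite mxE.
Qed.

Lemma dot_gt0 u : u != 0 -> 0 < dot u u.
Proof.
move=> u0; rewrite lt_neqAle; apply/andP; split.
  by apply: contra u0; rewrite eq_sym => /eqP/dot_eq0/eqP.
by rewrite /dot -!expr2 !addr_ge0 ?sqr_ge0.
Qed.

Lemma sphere2E x : sphere2 x = (dot x x = 1).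
Proof. by rewrite /sphere2/= row3_sum /dot -!expr2. Qed.

Lemma continuous_vec3 {T : topologicalType} (a b c : T -> R) :
  continuous a -> continuous b -> continuous c ->
  continuous (fun t => vec3 (a t) (b t) (c t)).
Proof.
move=> ca cb cc.
have -> : (fun t => vec3 (a t) (b t) (c t)) = (fun t =>
    a t *: vec3 1 0 0 + b t *: vec3 0 1 0 + c t *: vec3 0 0 1).
  by apply/funext => t; rewrite !vec3Z !vec3D; congr vec3; ring.
move=> t; apply: cvgD; [apply: cvgD|]; apply: cvgZr_tmp;
  [exact: ca|exact: cb|exact: cc].
Qed.

Lemma is_derive_dot (c d : R -> U) (t : R) c' d' :
  is_derive t (1 : R) c c' -> is_derive t (1 : R) d d' ->
  is_derive t (1 : R) (fun t => dot (c t) (d t)) (dot c' (d t) + dot (c t) d').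
Proof.
have dE (q : R -> U) q' i : is_derive t (1 : R) q q' ->
    is_derive t (1 : R) (fun t => q t 0 i) (q' 0 i).
  move=> [dq <-]; rewrite derive_mx// mxE; apply/derivableP.
  by move/derivable_mxP : dq.
move=> dc dd.
have hc i := dE c c' i dc; have hd i := dE d d' i dd.
have -> : (fun t => dot (c t) (d t)) = (fun t => c t 0 0) * (fun t => d t 0 0) +
   (fun t => c t 0 1) * (fun t => d t 0 1) +
   (fun t => c t 0 2) * (fun t => d t 0 2) by [].
have D := is_deriveD (is_deriveD (is_deriveM (hc 0) (hd 0))
  (is_deriveM (hc 1) (hd 1))) (is_deriveM (hc 2) (hd 2)).
by apply: (is_derive_eq D); rewrite /dot /GRing.scale/=; ring.
Qed.

Lemma smooth_is_derive {V : normedModType R} (c : R -> V) (t : R) :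
  smooth c -> is_derive t (1 : R) c (derive1 c t).
Proof.
move=> sc; rewrite derive1E; apply: derivableP; apply: diff_derivable.
exact: (sc 1%N).1.
Qed.

(** Differentiate the constant [dot (c t) (c t)] along a curve [c] on the sphere. *)
Lemma tangent_sphere2_dot x v : tangent sphere2 x v -> dot x v = 0.
Proof.
move=> [c [sc cS c0 <-]].
have D := is_derive_dot (smooth_is_derive 0 sc) (smooth_is_derive 0 sc).
have := @derive_val _ _ _ _ _ _ _ D.
have -> : (fun t => dot (c t) (c t)) = cst 1.
  by apply/funext => t; have := cS t; rewrite sphere2E.
by rewrite derive_cst c0 /dot => h; lra.
Qed.

(** The great circle [cos t x + sin t v] has velocity [v] at 0. *)
Lemma unit_tangent_sphere2 x v :
  dot x x = 1 -> dot v v = 1 -> dot x v = 0 -> tangent sphere2 x v.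
Proof.
move=> xx vv xv; pose c := trig x v 0.
have cx : c 0 = x by rewrite /c /trig cos0 sin0 scale1r scale0r !addr0.
rewrite -{1}cx; apply: (@tangent_trig _ _ _ c 0 x v 0) => [|//|].
  move=> t; rewrite sphere2E /c /trig addr0.
  have : dot (cos t *: x + sin t *: v) (cos t *: x + sin t *: v) =
      cos t ^+ 2 * dot x x + sin t ^+ 2 * dot v v + 2 * cos t * sin t * dot x v.
    by rewrite /dot !mxE; ring.
  by rewrite xx vv xv mulr0 addr0 !mulr1 cos2Dsin2.
by rewrite /trig cos0 sin0 scale1r scale0r !addr0.
Qed.

End Vectors.

(** * The round metric and weighted area forms *)

Section Sphere.
Context {R : realType}.
Local Notation U := 'rV[R]_3.
Implicit Types (u v w x : U) (F : U -> R).

Lemma is_derive_dotl w x u : is_derive x u (fun q : U => dot q w) (dot u w).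
Proof.
have H i : is_derive x u (fun q : U => w 0 i *: q 0 i) (w 0 i *: u 0 i).
  apply: is_deriveZ; apply: DeriveDef; last exact: derive_coord.
  exact/diff_derivable/differentiable_coord.
have := is_deriveD (is_deriveD (H 0) (H 1)) (H 2).
by rewrite /dot /GRing.scale/= ![w _ _ * _]mulrC; congr (is_derive _ _ _ _);
  apply/funext => q; rewrite !fctE ![w _ _ * _]mulrC.
Qed.

Lemma Ck_dotl w k : Ck k (fun q : U => dot q w).
Proof.
by rewrite /dot; do ?apply: CkD; apply: CkM; (exact: Ck_coord || exact: Ck_cst).
Qed.

Lemma dot_scalar u : scalar (dot u).
Proof. by move=> k v w; rewrite /dot !mxE; ring. Qed.

Lemma round_metric : riemannian_metric sphere2 (fun _ : U => dot).
Proof.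
split.
  split=> [_ u|_ v|u v].
  - exact: dot_scalar.
  - by move=> k u w; rewrite /dot !mxE; ring.
  - by move=> k; exact: Ck_cst.
move=> p _; split=> [u v _ _|u _]; last exact: dot_gt0.
by rewrite /dot; ring.
Qed.

(** Cramer's rule. Closedness of a weighted area form comes from applying the differential of the
    weight to this relation. *)
Lemma det3_cramer x u1 u2 u3 :
  det3 x u2 u3 *: u1 - det3 x u1 u3 *: u2 + det3 x u1 u2 *: u3
  = det3 u1 u2 u3 *: x.
Proof. by apply: row3P; rewrite /det3 /dot !coordE; ring. Qed.

(** Pairing Cramer's relation with [x] kills its left side and leaves the determinant on the
    right. *)
Lemma det3_tangent x u1 u2 u3 : dot x x = 1 ->
  dot x u1 = 0 -> dot x u2 = 0 -> dot x u3 = 0 -> det3 u1 u2 u3 = 0.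
Proof.
move=> xx h1 h2 h3; have := congr1 (dot x) (det3_cramer x u1 u2 u3).
have dZ k w : dot x (k *: w) = k * dot x w by rewrite /dot !mxE; ring.
have dD v w : dot x (v + w) = dot x v + dot x w by rewrite /dot !mxE; ring.
by rewrite !dD -scaleNr !dZ h1 h2 h3 xx => h; lra.
Qed.

(** The exterior derivative is [3 F det3 u1 u2 u3] plus [dF] applied to the left side of
    [det3_cramer]; both vanish on tangent vectors. For nondegeneracy, [u] is paired with a multiple
    of its quarter turn [cross p u]. *)
Lemma weighted_area_form_symplectic F : smooth F ->
  (forall x, dot x x = 1 -> 0 < F x) ->
  symplectic_form sphere2 (fun x u v => F x * det3 x u v).
Proof.
move=> sF F0; split.
  split.
    split; last by move=> p u; rewrite /det3 /dot !coordE; ring.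
    split=> [p u|p v|u v].
    - by move=> k v w; rewrite /det3 /dot !coordE; ring.
    - by move=> k u w; rewrite /det3 /dot !coordE; ring.
    - by move=> k; apply: CkM; [exact: sF|exact: Ck_dotl].
  move=> p u1 u2 u3; rewrite sphere2E => pp.
  move=> /tangent_sphere2_dot h1 /tangent_sphere2_dot h2.
  move=> /tangent_sphere2_dot h3.
  have dF : differentiable F p := (sF 1%N).1 p.
  have DE u v w : 'D_u (fun q => F q * det3 q v w) p =
      F p * det3 u v w + det3 p v w * 'D_u F p.
    have D1 : is_derive p u F ('D_u F p) by exact/derivableP/diff_derivable.
    exact: (@derive_val _ _ _ _ _ _ _ (is_deriveM D1 (is_derive_dotl _ p u))).
  rewrite /ext_d2 !DE.
  have D0 := congr1 ('d F p) (det3_cramer p u1 u2 u3).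
  have u0 := det3_tangent pp h1 h2 h3.
  move: D0; rewrite u0 scale0r linear0 linearD linearB !linearZ /= -!deriveE//.
  rewrite /GRing.scale/= => D0.
  have -> : det3 u2 u1 u3 = - det3 u1 u2 u3 by rewrite /det3 /dot !coordE; ring.
  have -> : det3 u3 u1 u2 = det3 u1 u2 u3 by rewrite /det3 /dot !coordE; ring.
  by rewrite u0; lra.
move=> p u; rewrite sphere2E => pp /tangent_sphere2_dot pu /dot_gt0 uu.
(* Scaling by [k] makes [cross p u] a unit vector, so that [unit_tangent_sphere2] applies. *)
pose k := (Num.sqrt (dot u u))^-1.
have k0 : 0 < k by rewrite invr_gt0 sqrtr_gt0.
have k2 : k ^+ 2 * dot u u = 1.
  by rewrite exprVn sqr_sqrtr ?(ltW uu)// mulVf// gt_eqF.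
have lag v : dot (cross p v) (cross p v) = dot p p * dot v v - dot p v ^+ 2.
  by rewrite /dot !coordE; ring.
exists (k *: cross p u).
  apply: unit_tangent_sphere2 => //.
    have -> : dot (k *: cross p u) (k *: cross p u) =
        k ^+ 2 * dot (cross p u) (cross p u) by rewrite /dot !coordE; ring.
    by rewrite lag pp pu mul1r expr0n subr0.
  by rewrite /dot !coordE; ring.
have -> : det3 p u (k *: cross p u) = k * (dot p p * dot u u - dot p u ^+ 2).
  by rewrite /det3 /dot !coordE; ring.
rewrite pp pu mul1r expr0n subr0 gt_eqF// !mulr_gt0//.
exact: F0.
Qed.

End Sphere.

(** * The energy level of the round metric for [m = 1] *)

Section UnitTangentBundle.
Context {R : realType}.
Local Notation U := 'rV[R]_3.
Local Notation g := (fun _ : U => @dot R).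
Local Notation Sigma := (energy_level g 1).
Implicit Types (u v w x : U) (F : U -> R) (p xi eta : U * U).

(** Since [m = 1] means unit speed, great circles suffice for the converse. *)
Lemma unit_tangent_bundleP p : Sigma p <->
  [/\ dot p.1 p.1 = 1, dot p.1 p.2 = 0 & dot p.2 p.2 = 1].
Proof.
rewrite /energy_level /tangent_bundle /energy /=; split.
  by move=> [[]]; rewrite sphere2E => h1 /tangent_sphere2_dot h2 h3; split=> //;
    lra.
move=> [h1 h2 h3]; rewrite sphere2E h3; split; last by lra.
by split=> //; exact: unit_tangent_sphere2.
Qed.

(** Differentiate the three equations of [unit_tangent_bundleP] along a curve in [Sigma]. *)
Lemma tangent_unit_tangent_bundle p xi : tangent Sigma p xi ->
  [/\ dot p.1 xi.1 = 0, dot xi.1 p.2 + dot p.1 xi.2 = 0 & dot p.2 xi.2 = 0].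
Proof.
move=> [c [sc cS c0 <-]].
have D := smooth_is_derive 0 sc.
have D1 : is_derive (0 : R) (1 : R) (fun t => (c t).1) (derive1 c 0).1.
  by apply: (is_derive_comp_linear (f := fst)) D; move=> ?; exact: cvg_fst.
have D2 : is_derive (0 : R) (1 : R) (fun t => (c t).2) (derive1 c 0).2.
  by apply: (is_derive_comp_linear (f := snd)) D; move=> ?; exact: cvg_snd.
have cst_dot (f : R -> R) (k d : R) : (forall t, f t = k) ->
    is_derive (0 : R) (1 : R) f d -> d = 0.
  move=> fk [_ <-]; have -> : f = cst k by apply/funext => t; rewrite fk.
  exact: derive_cst.
have cP t := (unit_tangent_bundleP (c t)).1 (cS t).
have h1 := cst_dot _ 1 _ (fun t => let: And3 h _ _ := cP t in h)
  (is_derive_dot D1 D1).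
have h2 := cst_dot _ 0 _ (fun t => let: And3 _ h _ := cP t in h)
  (is_derive_dot D1 D2).
have h3 := cst_dot _ 1 _ (fun t => let: And3 _ _ h := cP t in h)
  (is_derive_dot D2 D2).
move: h1 h2 h3; rewrite c0 => h1 h2 h3.
by split=> //; move: h1 h3; rewrite /dot => h1 h3; lra.
Qed.

(** The metric tensor [dot] is constant on [R^3], so [lambda] is [v . dx] and its differential is
    [dv /\ dx]. *)
Lemma omega_round F p xi eta :
  omega g (fun x u v => F x * det3 x u v) p xi eta =
  dot xi.2 eta.1 - dot eta.2 xi.1 - F p.1 * det3 p.1 xi.1 eta.1.
Proof.
have dfst (q u : U * U) : 'd (@bundle_proj R) q u = u.1.
  by rewrite (diff_lin (f := fst))//; move=> ?; exact: cvg_fst.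
have D (u v : U * U) : 'D_u (fun q => lambda g q v) p = dot u.2 v.1.
  have -> : (fun q => lambda g q v) = (fun x => dot x v.1) \o snd.
    by apply/funext => q; rewrite /lambda dfst.
  have ds : differentiable (@snd U U) p.
    by apply: (linear_differentiable (f := snd)) => ?; exact: cvg_snd.
  have dd : differentiable (fun x => dot x v.1) (snd p).
    exact: (Ck_dotl v.1 1%N).1.
  rewrite deriveE; last exact: differentiable_comp.
  rewrite diff_comp//= -deriveE// (diff_lin (f := snd)).
    exact: (@derive_val _ _ _ _ _ _ _ (is_derive_dotl _ _ _)).
  by move=> ?; exact: cvg_snd.
by rewrite /omega /ext_d1 !D /pullback2 !dfst.
Qed.

End UnitTangentBundle.

(** * The magnetic vector field and the contact condition *)

Section ReebVanishing.
Context {R : realType}.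
Local Notation U := 'rV[R]_3.
Local Notation Sigma := (energy_level (fun _ : U => @dot R) 1).
Implicit Types (u v w x : U) (F : U -> R) (p xi eta : U * U).

(** The acceleration is [F] times the quarter turn of the velocity; the term [- p.1] is the normal
    acceleration that keeps a curve of unit speed on the sphere. *)
Definition magnetic_vector_field F p : U * U :=
  (p.2, F p.1 *: cross p.1 p.2 - p.1).

(* [magnetic_vector_field F p] spans the kernel of [omega] on the tangent space
   of [Sigma] at [p]; if [a] kills it as well, then [a] and [omega] both live on
   a quotient of dimension 2. *)
Lemma wedge_eq0 F (a : U * U -> U * U -> R) p (u1 u2 u3 : U * U) :
  is_primitive_on Sigma a
    (omega (fun _ => @dot R) (fun x u v => F x * det3 x u v)) ->
  one_form a -> Sigma p -> a p (magnetic_vector_field F p) = 0 ->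
  tangent Sigma p u1 -> tangent Sigma p u2 -> tangent Sigma p u3 ->
  wedge12 a (ext_d1 a) p u1 u2 u3 = 0.
Proof.
move=> aP [a_lin _] Sp aX.
have [xx xv vv] := (unit_tangent_bundleP p).1 Sp.
move: aX; case: p => x v /= in aP a_lin Sp xx xv vv *; move=> aX.
set n := cross x v in aX.
have xn : dot x n = 0 by rewrite /n /dot !coordE; ring.
have vn : dot v n = 0 by rewrite /n /dot !coordE; ring.
have nn : dot n n = 1.
  have -> : dot n n = dot x x * dot v v - dot x v ^+ 2.
    by rewrite /n /dot !coordE; ring.
  by rewrite xx xv vv mulr1 expr0n subr0.
have frame w : w = dot x w *: x + dot v w *: v + dot n w *: n.
  have E : dot n n *: w = (dot v v * dot x w - dot x v * dot v w) *: x +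
      (dot x x * dot v w - dot x v * dot x w) *: v + dot n w *: n.
    by apply: row3P; rewrite /n /dot !coordE; ring.
  move: E; rewrite nn xx xv vv !mul1r !mul0r !subr0 scale1r.
  exact.
pose N1 : U * U := (n, 0); pose N2 : U * U := (0, n).
(* Modulo the magnetic vector field, [b] and [c] are coordinates on the tangent space: [c] is the
   vertical component along [n] left after subtracting [dot v xi.1] times the field. *)
pose b (xi : U * U) := dot n xi.1.
pose c (xi : U * U) := dot n xi.2 - F x * dot v xi.1.
have dec (xi : U * U) : tangent Sigma (x, v) xi ->
    xi.1 = dot v xi.1 *: v + b xi *: n /\
    xi.2 = - dot v xi.1 *: x + dot n xi.2 *: n.
  move=> /tangent_unit_tangent_bundle[/= h1 h2 h3]; split.
    by rewrite {1}[xi.1]frame h1 scale0r add0r.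
  rewrite {1}[xi.2]frame h3 scale0r addr0; congr (_ *: _ + _).
  by move: h2; rewrite /dot => h2; lra.
have decX (xi : U * U) : tangent Sigma (x, v) xi ->
    xi = dot v xi.1 *: magnetic_vector_field F (x, v)
         + (b xi *: N1 + c xi *: N2).
  move=> /dec[e1 e2]; rewrite [LHS]surjective_pairing.
  rewrite /magnetic_vector_field /N1 /N2 /c /=; congr pair.
    by rewrite /= scaler0 addr0.
  rewrite /= scaler0 add0r [LHS]e2 -/n.
  by apply: row3P; rewrite !mxE; ring.
have a0 : a (x, v) 0 = 0.
  by have := a_lin (x, v) 1 0 0; rewrite scaler0 addr0 mul1r => h; lra.
have aE (xi : U * U) : tangent Sigma (x, v) xi ->
    a (x, v) xi = b xi * a (x, v) N1 + c xi * a (x, v) N2.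
  move=> /decX {1}->; rewrite a_lin aX mulr0 add0r a_lin.
  by have := a_lin (x, v) (c xi) N2 0; rewrite addr0 a0 addr0 => ->.
have oE (xi eta : U * U) : tangent Sigma (x, v) xi ->
    tangent Sigma (x, v) eta ->
    ext_d1 a (x, v) xi eta = c xi * b eta - c eta * b xi.
  move=> txi teta; rewrite aP// omega_round /= /c.
  have [[e1 e2] [f1 f2]] := (dec _ txi, dec _ teta).
  have dE k l k' l' : dot (- k *: x + l *: n) (k' *: v + l' *: n) = l * l'.
    have -> : dot (- k *: x + l *: n) (k' *: v + l' *: n) = - (k * k') * dot x v
        - k * l' * dot x n + l * k' * dot v n + l * l' * dot n n.
      by rewrite /dot !mxE; ring.
    by rewrite xv xn vn nn; ring.
  have detE k l k' l' :
      det3 x (k *: v + l *: n) (k' *: v + l' *: n) = k * l' - k' * l.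
    have -> : det3 x (k *: v + l *: n) (k' *: v + l' *: n) =
        (k * l' - k' * l) * det3 x v n by rewrite /det3 /dot !coordE; ring.
    have -> : det3 x v n = dot n n by rewrite /det3 /n /dot !coordE; ring.
    by rewrite nn mulr1.
  rewrite [in dot xi.2 _]e2 [in dot _ eta.1]f1 dE.
  rewrite [in dot eta.2 _]f2 [in dot _ xi.1]e1 dE.
  rewrite [in det3 _ xi.1 _]e1 [in det3 _ _ eta.1]f1 detE.
  by ring.
move=> t1 t2 t3; rewrite /wedge12.
rewrite (aE _ t1) (aE _ t2) (aE _ t3) (oE _ _ t2 t3) (oE _ _ t1 t3).
rewrite (oE _ _ t1 t2).
move: (a _ N1) (a _ N2) (b _) (b _) (b _) (c _) (c _) (c _).
by move=> *; ring.
Qed.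

End ReebVanishing.

(** * The standard frame of [R^3 x R^3] *)

Section PairBasis.
Context {R : realType}.
Local Notation U := 'rV[R]_3.

Definition pair_coord (i : 'I_(3 + 3)) (p : U * U) : R^o :=
  match fintype.split i with inl j => p.1 0 j | inr j => p.2 0 j end.

Definition pair_basis (i : 'I_(3 + 3)) : U * U :=
  match fintype.split i with
  | inl j => (delta_mx 0 j, 0)
  | inr j => (0, delta_mx 0 j)
  end.

Fact pair_coord_linear i : linear (pair_coord i).
Proof.
by move=> k p q; rewrite /pair_coord; case: fintype.split => j; rewrite !mxE.
Qed.

HB.instance Definition _ i :=
  GRing.isLinear.Build R (U * U)%type R^o _
    (pair_coord i) (pair_coord_linear i).

Definition pair_colin (i : 'I_(3 + 3)) : {linear (U * U)%type -> R^o} :=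
  pair_coord i.

Lemma pair_colin_continuous i : continuous (pair_colin i).
Proof.
rewrite /pair_colin /= /pair_coord; case: fintype.split => j p.
  apply: (continuous_comp (f := fst) (g := fun q : U => q 0 j)).
    exact: cvg_fst.
  exact: coord_continuous.
apply: (continuous_comp (f := snd) (g := fun q : U => q 0 j)).
  exact: cvg_snd.
exact: coord_continuous.
Qed.

Lemma pair_colin_sum (p : U * U) : p = \sum_i pair_colin i p *: pair_basis i.
Proof.
rewrite -[RHS]/(\sum_i pair_coord i p *: pair_basis i) big_split_ord.
rewrite /pair_coord /pair_basis /=.
under eq_bigr => j _ do rewrite -[lshift _ j]/(unsplit (inl j)) unsplitK.
under [X in _ + X]eq_bigr => j _ do
  rewrite -[rshift _ j]/(unsplit (inr j)) unsplitK.
case: p => x v /=; congr pair => /=.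
  rewrite !(raddf_sum fst)/= [X in _ + X]big1 ?addr0; last first.
    by move=> *; rewrite scaler0.
  exact: row_sum_delta.
rewrite !(raddf_sum snd)/= big1 ?add0r; last by move=> *; rewrite scaler0.
exact: row_sum_delta.
Qed.

Lemma pair_is_frame : is_frame pair_basis pair_colin.
Proof. split; [exact: pair_colin_continuous|exact: pair_colin_sum]. Qed.

End PairBasis.

(** Substitution of [T - t]; it serves to compare the two directions around the fibre over the south
    pole. *)
Lemma Rintegral_reverse {R : realType} (f : R -> R) (T : R) : 0 < T ->
  continuous f ->
  \int[lebesgue_measure]_(t in `[0, T]) f (T - t) =
  \int[lebesgue_measure]_(t in `[0, T]) f t.
Proof.
move=> T0 cf; have dr (x : R) : is_derive x (1 : R) (fun t => T - t) (- 1).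
  by rewrite -[- 1]sub0r; exact: is_deriveB.
have dE : derive1 (fun t => T - t) = cst (- 1).
  by apply/funext => x; rewrite derive1E derive_val.
have cr : continuous (fun t : R => T - t).
  move=> t; apply/differentiable_continuous/derivable1_diffP.
  exact: (@ex_derive _ _ _ _ _ _ _ (dr t)).
have := @integration_by_substitution_decreasing R (fun t => T - t) f 0 T
  (ltW T0).
rewrite subrr subr0 dE /Rintegral => ->.
- congr fine; apply: eq_integral => t _ /=.
  by rewrite !fctE opprK mulr1.
- by move=> x y _ _ xy; rewrite ltrD2l ltrN2.
- by move=> x _; exact: cvg_cst.
- exact: is_cvg_cst.
- exact: is_cvg_cst.
- split=> [t _||].
  + exact: (@ex_derive _ _ _ _ _ _ _ (dr t)).
  + exact/cvg_at_right_filter/cr.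
  + exact/cvg_at_left_filter/cr.
- exact: continuous_subspaceT.
Qed.

(** * Two families of loops in the unit tangent bundle *)

Section LoopFamilies.
Context {R : realType}.
Local Notation U := 'rV[R]_3.
Local Notation W := (U * U)%type.
Local Notation Sigma := (energy_level (fun _ : U => @dot R) 1).

(** A curve packaged with its velocity: one choice of coefficients yields derivative, continuity and
    tangency together. *)
Definition trig_motion (c c' : R -> W) :=
  exists A B C, c = trig A B C /\ c' = trig B (- A) 0.

Lemma is_derive_trig_motion c c' (t : R) : trig_motion c c' ->
  is_derive t (1 : R) c (c' t).
Proof. by move=> [A [B [C [-> ->]]]]; exact: is_derive_trig. Qed.

Lemma trig_motion_continuous c c' : trig_motion c c' ->
  continuous c /\ continuous c'.
Proof.
by move=> [A [B [C [-> ->]]]]; split; apply: (smooth_trig _ _ _ 0%N).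
Qed.

Lemma tangent_trig_motion (M : set W) c c' t : trig_motion c c' ->
  (forall t, M (c t)) -> tangent M (c t) (c' t).
Proof.
move=> [A [B [C [cE c'E]]]] Mc.
by apply: (tangent_trig Mc cE); rewrite c'E.
Qed.

Lemma trig_pair (A1 A2 B1 B2 C1 C2 : U) t :
  trig (A1, A2) (B1, B2) (C1, C2) t = (trig A1 B1 C1 t, trig A2 B2 C2 t).
Proof. by []. Qed.

Lemma trig_vec3 (a1 a2 a3 b1 b2 b3 c1 c2 c3 t : R) :
  trig (vec3 a1 a2 a3) (vec3 b1 b2 b3) (vec3 c1 c2 c3) t =
  vec3 (cos t * a1 + sin t * b1 + c1) (cos t * a2 + sin t * b2 + c2)
       (cos t * a3 + sin t * b3 + c3).
Proof. by rewrite /trig !vec3Z !vec3D. Qed.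

Lemma pair_vec30 : (0 : W) = (vec3 0 0 0, vec3 0 0 0).
Proof. by rewrite -vec30. Qed.

Lemma pair_vec3N (a b c a' b' c' : R) :
  - ((vec3 a b c, vec3 a' b' c') : W) =
  (vec3 (- a) (- b) (- c), vec3 (- a') (- b') (- c')).
Proof. by rewrite -!vec3N. Qed.

(* The rotations of [((sin s, 0, cos s), e_2)] about the third axis. *)
Definition axis_loop (s t : R) : W :=
  (vec3 (sin s * cos t) (sin s * sin t) (cos s), vec3 (- sin t) (cos t) 0).
Definition axis_loop_s (s t : R) : W :=
  (vec3 (cos s * cos t) (cos s * sin t) (- sin s), vec3 0 0 0).
Definition axis_loop_t (s t : R) : W :=
  (vec3 (- (sin s * sin t)) (sin s * cos t) 0, vec3 (- cos t) (- sin t) 0).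
Definition axis_loop_st (s t : R) : W :=
  (vec3 (- (cos s * sin t)) (cos s * cos t) 0, vec3 0 0 0).

(* The rotations of the same vector about its base point [(sin s, 0, cos s)]. *)
Definition fiber_loop (s t : R) : W :=
  (vec3 (sin s) 0 (cos s), vec3 (- (sin t * cos s)) (cos t) (sin t * sin s)).
Definition fiber_loop_s (s t : R) : W :=
  (vec3 (cos s) 0 (- sin s), vec3 (sin t * sin s) 0 (sin t * cos s)).
Definition fiber_loop_t (s t : R) : W :=
  (vec3 0 0 0, vec3 (- (cos t * cos s)) (- sin t) (cos t * sin s)).
Definition fiber_loop_st (s t : R) : W :=
  (vec3 0 0 0, vec3 (cos t * sin s) 0 (cos t * cos s)).

Ltac trig_motion_tac :=
  split; apply/funext => ?;
  rewrite ?pair_vec3N ?pair_vec30 trig_pair !trig_vec3;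
  congr (vec3 _ _ _, vec3 _ _ _); ring.

(** The witnesses here and in the next seven lemmas are the coefficients of the cosine, the sine and
    1 in the moving variable. *)
Lemma axis_loop_motion_s t : trig_motion (axis_loop^~ t) (axis_loop_s^~ t).
Proof.
exists (vec3 0 0 1, vec3 0 0 0), (vec3 (cos t) (sin t) 0, vec3 0 0 0),
  (vec3 0 0 0, vec3 (- sin t) (cos t) 0).
trig_motion_tac.
Qed.

Lemma axis_loop_motion_t s : trig_motion (axis_loop s) (axis_loop_t s).
Proof.
exists (vec3 (sin s) 0 0, vec3 0 1 0), (vec3 0 (sin s) 0, vec3 (- 1) 0 0),
  (vec3 0 0 (cos s), vec3 0 0 0).
trig_motion_tac.
Qed.

Lemma axis_loop_motion_ts t : trig_motion (axis_loop_t^~ t) (axis_loop_st^~ t).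
Proof.
exists (vec3 0 0 0, vec3 0 0 0), (vec3 (- sin t) (cos t) 0, vec3 0 0 0),
  (vec3 0 0 0, vec3 (- cos t) (- sin t) 0).
trig_motion_tac.
Qed.

Lemma axis_loop_motion_st s : trig_motion (axis_loop_s s) (axis_loop_st s).
Proof.
exists (vec3 (cos s) 0 0, vec3 0 0 0), (vec3 0 (cos s) 0, vec3 0 0 0),
  (vec3 0 0 (- sin s), vec3 0 0 0).
trig_motion_tac.
Qed.

Lemma fiber_loop_motion_s t : trig_motion (fiber_loop^~ t) (fiber_loop_s^~ t).
Proof.
exists (vec3 0 0 1, vec3 (- sin t) 0 0), (vec3 1 0 0, vec3 0 0 (sin t)),
  (vec3 0 0 0, vec3 0 (cos t) 0).
trig_motion_tac.
Qed.

Lemma fiber_loop_motion_t s : trig_motion (fiber_loop s) (fiber_loop_t s).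
Proof.
exists (vec3 0 0 0, vec3 0 1 0), (vec3 0 0 0, vec3 (- cos s) 0 (sin s)),
  (vec3 (sin s) 0 (cos s), vec3 0 0 0).
trig_motion_tac.
Qed.

Lemma fiber_loop_motion_ts t :
  trig_motion (fiber_loop_t^~ t) (fiber_loop_st^~ t).
Proof.
exists (vec3 0 0 0, vec3 (- cos t) 0 0), (vec3 0 0 0, vec3 0 0 (cos t)),
  (vec3 0 0 0, vec3 0 (- sin t) 0).
trig_motion_tac.
Qed.

Lemma fiber_loop_motion_st s : trig_motion (fiber_loop_s s) (fiber_loop_st s).
Proof.
exists (vec3 0 0 0, vec3 0 0 0), (vec3 0 0 0, vec3 (sin s) 0 (cos s)),
  (vec3 (cos s) 0 (- sin s), vec3 0 0 0).
trig_motion_tac.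
Qed.

Lemma axis_loop_in s t : Sigma (axis_loop s t).
Proof.
apply/unit_tangent_bundleP; rewrite /dot /= !vec3E.
have hs := sin2cos2 s; have ht := sin2cos2 t.
by split; ring: hs ht.
Qed.

Lemma fiber_loop_in s t : Sigma (fiber_loop s t).
Proof.
apply/unit_tangent_bundleP; rewrite /dot /= !vec3E.
have hs := sin2cos2 s; have ht := sin2cos2 t.
by split; ring: hs ht.
Qed.

Lemma continuous_pair_vec3 {T : topologicalType} (a b c a' b' c' : T -> R) :
  continuous a -> continuous b -> continuous c ->
  continuous a' -> continuous b' -> continuous c' ->
  continuous (fun t => (vec3 (a t) (b t) (c t), vec3 (a' t) (b' t) (c' t)) : W).
Proof.
move=> ca cb cc ca' cb' cc' t.
have h1 := @continuous_vec3 _ _ _ _ _ ca cb cc t.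
have h2 := @continuous_vec3 _ _ _ _ _ ca' cb' cc' t.
exact: (@cvg_pair _ _ _ (nbhs t) _ _ _ _ _ _ _ h1 h2).
Qed.

Lemma cos1_continuous : continuous (fun p : R * R => cos p.1).
Proof.
by move=> p; apply: (continuous_comp (f := fst));
  [exact: cvg_fst|exact: continuous_cos].
Qed.
Lemma sin1_continuous : continuous (fun p : R * R => sin p.1).
Proof.
by move=> p; apply: (continuous_comp (f := fst));
  [exact: cvg_fst|exact: continuous_sin].
Qed.
Lemma cos2_continuous : continuous (fun p : R * R => cos p.2).
Proof.
by move=> p; apply: (continuous_comp (f := snd));
  [exact: cvg_snd|exact: continuous_cos].
Qed.
Lemma sin2_continuous : continuous (fun p : R * R => sin p.2).
Proof.
by move=> p; apply: (continuous_comp (f := snd));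
  [exact: cvg_snd|exact: continuous_sin].
Qed.

Ltac cont_tac := apply: continuous_pair_vec3 => p;
  repeat first [exact: cvg_cst | exact: cos1_continuous | exact: sin1_continuous
    | exact: cos2_continuous | exact: sin2_continuous
    | apply: cvgN | apply: cvgM].

Lemma axis_loop_continuous : continuous (fun p : R * R => axis_loop p.1 p.2).
Proof. cont_tac. Qed.
Lemma axis_loop_s_continuous :
  continuous (fun p : R * R => axis_loop_s p.1 p.2).
Proof. cont_tac. Qed.
Lemma axis_loop_t_continuous :
  continuous (fun p : R * R => axis_loop_t p.1 p.2).
Proof. cont_tac. Qed.
Lemma axis_loop_st_continuous :
  continuous (fun p : R * R => axis_loop_st p.1 p.2).
Proof. cont_tac. Qed.
Lemma fiber_loop_continuous : continuous (fun p : R * R => fiber_loop p.1 p.2).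
Proof. cont_tac. Qed.
Lemma fiber_loop_s_continuous :
  continuous (fun p : R * R => fiber_loop_s p.1 p.2).
Proof. cont_tac. Qed.
Lemma fiber_loop_t_continuous :
  continuous (fun p : R * R => fiber_loop_t p.1 p.2).
Proof. cont_tac. Qed.
Lemma fiber_loop_st_continuous :
  continuous (fun p : R * R => fiber_loop_st p.1 p.2).
Proof. cont_tac. Qed.

End LoopFamilies.

(** * The field strength and the loop integrals of a primitive *)

Section MagneticSystem.
Context {R : realType}.
Local Notation U := 'rV[R]_3.
Local Notation W := (U * U)%type.
Local Notation Sigma := (energy_level (fun _ : U => @dot R) 1).
Local Notation mu := (@lebesgue_measure R).

Context (b c : R) (b_gt0 : 0 < b) (c_ge0 : 0 <= c).

Definition strength (z : R) : R := b + c * (z ^+ 6 + z ^+ 7).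

(** The primitive [h] of [strength] that vanishes at 0. *)
Definition potential (z : R) : R := b * z + c * (z ^+ 7 / 7 + z ^+ 8 / 8).

(** The two powers add up to [z^6 (1 + z)], which is nonnegative on [[-1, 1]]. *)
Lemma strength_gt0 z : -1 <= z <= 1 -> 0 < strength z.
Proof.
move=> /andP[z1 z2]; rewrite ltr_pwDl// mulr_ge0//.
have -> : z ^+ 6 + z ^+ 7 = (z ^+ 3) ^+ 2 * (1 + z) by ring.
by rewrite mulr_ge0 ?sqr_ge0//; lra.
Qed.

Definition field (x u v : U) : R := strength (x 0 2) * det3 x u v.

Lemma field_symplectic : symplectic_form sphere2 field.
Proof.
apply: (weighted_area_form_symplectic (F := fun x => strength (x 0 2))).
  move=> k.
  apply: CkD; first exact: Ck_cst.
  apply: CkM; first exact: Ck_cst.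
  by apply: CkD; apply: CkX; exact: Ck_coord.
move=> x xx; apply: strength_gt0.
have : x 0 2 ^+ 2 <= 1.
  by rewrite -xx /dot -!expr2 lerDr addr_ge0 ?sqr_ge0.
by move=> h; apply/andP; split; nra.
Qed.

(* The momentum map of the rotations, restricted to [axis_loop s 0]. *)
Lemma is_derive_momentum (s : R) :
  is_derive s (1 : R) (fun s => sin s + potential (cos s))
    (cos s - strength (cos s) * sin s).
Proof.
have dc := is_derive_cos s.
have D := is_deriveD (is_derive_sin s) (is_deriveD (is_deriveD
  (is_deriveZ b dc)
  (is_deriveZ (c / 7) (is_deriveX 7 dc)))
  (is_deriveZ (c / 8) (is_deriveX 8 dc))).
have -> : (fun s => sin s + potential (cos s)) =
    sin + (b *: cos + (c / 7) *: (cos ^+ 7) + (c / 8) *: (cos ^+ 8))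
    :> (R -> R).
  apply/funext => t; rewrite /potential !fctE /GRing.scale/=.
  by field.
apply: (is_derive_eq D); rewrite /strength /GRing.scale/=.
by field.
Qed.

Context (a : W -> W -> R) (a_form : one_form a).
Context (a_prim : is_primitive_on Sigma a (omega (fun _ => @dot R) field)).

Let T : R := pi *+ 2.

Let T_gt0 : 0 < T. Proof. by rewrite /T pmulrn_lgt0// pi_gt0. Qed.

Let axis_integral s :=
  \int[mu]_(t in `[0, T]) a (axis_loop s t) (axis_loop_t s t).
Let fiber_integral s :=
  \int[mu]_(t in `[0, T]) a (fiber_loop s t) (fiber_loop_t s t).

(** By Stokes the derivative is the integral of [omega] on the two partial derivatives of the loop
    family. Rotations preserve [omega], so this integrand is constant in [t]. *)
Let axis_integral_derive s : is_derive s (1 : R) axis_integral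
  ((cos s - strength (cos s) * sin s) * T).
Proof.
apply: is_derive_eq.
  apply: (is_derive_loop_integral pair_is_frame a_form T_gt0
    (fun s t => is_derive_trig_motion s (axis_loop_motion_s t))
    (fun s t => is_derive_trig_motion t (axis_loop_motion_t s))
    (fun s t => is_derive_trig_motion s (axis_loop_motion_ts t))
    (fun s t => is_derive_trig_motion t (axis_loop_motion_st s))
    axis_loop_continuous axis_loop_s_continuous axis_loop_t_continuous
    axis_loop_st_continuous).
    by rewrite /axis_loop /T ?cos2pi ?sin2pi ?cos0 ?sin0.
  by rewrite /axis_loop_s /T ?cos2pi ?sin2pi ?cos0 ?sin0.
pose k := cos s - strength (cos s) * sin s.
transitivity (\int[mu]_(t in `[0, T]) k).
  apply: eq_Rintegral => t _.
  rewrite a_prim; first last.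
  - exact: (tangent_trig_motion _ (axis_loop_motion_t s) (axis_loop_in s)).
  - exact: (tangent_trig_motion _ (axis_loop_motion_s t) (axis_loop_in^~ t)).
  - exact: axis_loop_in.
  rewrite /field omega_round /= !vec3E /det3 /dot !vec3E /k.
  have hs := sin2cos2 s; have ht := sin2cos2 t.
  by ring: hs ht.
have dk (t : R) : is_derive t (1 : R) (fun t => k * t) k.
  have := is_deriveZ k (is_derive_id t (1 : R)).
  by rewrite /GRing.scale/= mulr1.
have ck : continuous (fun _ : R => k) by move=> ?; exact: cvg_cst.
by rewrite (Rintegral_derive T_gt0 dk ck) mulr0 subr0.
Qed.

(** Along a fibre the base point stands still, so the area term drops out of [omega]; what is left
    is [cos t], whose integral over a period is 0. *)
Let fiber_integral_derive s : is_derive s (1 : R) fiber_integral 0.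
Proof.
apply: is_derive_eq.
  apply: (is_derive_loop_integral pair_is_frame a_form T_gt0
    (fun s t => is_derive_trig_motion s (fiber_loop_motion_s t))
    (fun s t => is_derive_trig_motion t (fiber_loop_motion_t s))
    (fun s t => is_derive_trig_motion s (fiber_loop_motion_ts t))
    (fun s t => is_derive_trig_motion t (fiber_loop_motion_st s))
    fiber_loop_continuous fiber_loop_s_continuous fiber_loop_t_continuous
    fiber_loop_st_continuous).
    by rewrite /fiber_loop /T ?cos2pi ?sin2pi ?cos0 ?sin0.
  by rewrite /fiber_loop_s /T ?cos2pi ?sin2pi ?cos0 ?sin0.
transitivity (\int[mu]_(t in `[0, T]) cos t).
  apply: eq_Rintegral => t _.
  rewrite a_prim; first last.
  - exact: (tangent_trig_motion _ (fiber_loop_motion_t s) (fiber_loop_in s)).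
  - exact: (tangent_trig_motion _ (fiber_loop_motion_s t) (fiber_loop_in^~ t)).
  - exact: fiber_loop_in.
  rewrite /field omega_round /= !vec3E /det3 /dot !vec3E.
  have hs := sin2cos2 s.
  by ring: hs.
rewrite (Rintegral_derive T_gt0 (@is_derive_sin R) (@continuous_cos R)).
by rewrite /T sin2pi sin0 subr0.
Qed.

Let one_formN p u : a p (- u) = - a p u.
Proof.
have a0 : a p 0 = 0.
  by have := a_form.1 p 1 0 0; rewrite scaler0 addr0 mul1r => h; lra.
by have := a_form.1 p (- 1) u 0; rewrite scaleN1r a0 !addr0 mulN1r.
Qed.

Let axis_integrand_continuous s :
  continuous (fun t => a (axis_loop s t) (axis_loop_t s t)).
Proof.
have [c1 c2] := trig_motion_continuous (axis_loop_motion_t s).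
exact: (continuous_one_form pair_is_frame a_form c1 c2).
Qed.

(* The fibre over the south pole is traversed backwards by the rotations about
   the third axis. *)
Let pole_integrals : axis_integral 0 + axis_integral pi = 0.
Proof.
have -> : axis_integral 0 = fiber_integral 0.
  apply: eq_Rintegral => t _.
  rewrite /axis_loop /axis_loop_t /fiber_loop /fiber_loop_t sin0 cos0.
  by rewrite !mul0r !mulr1 !mulr0 oppr0.
have -> : fiber_integral 0 = fiber_integral pi.
  exact: is_derive_0_is_cst.
rewrite /fiber_integral -[RHS](addNr (axis_integral pi)); congr (_ + _).
have rev : \int[mu]_(t in `[0, T])
    a (axis_loop pi (T - t)) (axis_loop_t pi (T - t)) = axis_integral pi :=
  Rintegral_reverse T_gt0 (@axis_integrand_continuous pi).
rewrite -[RHS]mulN1r -rev.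
rewrite -RintegralZl//; last first.
  apply: continuous_integrable_itv => t.
  apply: (continuous_comp (f := fun t => T - t)
    (g := fun t => a (axis_loop pi t) (axis_loop_t pi t))); last first.
    exact: axis_integrand_continuous.
  by apply: cvgB; [exact: cvg_cst|exact: cvg_id].
apply: eq_Rintegral => t _; rewrite mulN1r -one_formN.
rewrite /axis_loop /axis_loop_t /fiber_loop /fiber_loop_t cospi sinpi.
rewrite pair_vec3N sinB cosB /T cos2pi sin2pi.
by congr (a (vec3 _ _ _, vec3 _ _ _) (vec3 _ _ _, vec3 _ _ _)); ring.
Qed.

(** The integral and [T] times the momentum have the same derivative, hence differ by a constant.
    Adding the values at 0 and [pi], where the integrals cancel, identifies the constant. *)
Let axis_integral_eq0 s :
  2 * (sin s + potential (cos s)) = potential 1 + potential (- 1) ->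
  axis_integral s = 0.
Proof.
move=> hs; have cstE x y : axis_integral x - T * (sin x + potential (cos x)) =
    axis_integral y - T * (sin y + potential (cos y)).
  apply: (is_derive_0_is_cst (f := fun s =>
    axis_integral s - T * (sin s + potential (cos s)))) => t.
  have D := is_deriveB (axis_integral_derive t)
    (is_deriveZ T (is_derive_momentum t)).
  by apply: (is_derive_eq D); rewrite /GRing.scale/=; ring.
have := cstE s 0; have := cstE s pi; have := pole_integrals.
rewrite sin0 cos0 sinpi cospi !add0r => h0 h1 h2.
have : T * (2 * (sin s + potential (cos s))) =
    T * (potential 1 + potential (- 1)).
  by rewrite hs.
by move=> h3; lra.
Qed.

(** The first hypothesis makes the parallel of height [3 / 5] and radius [4 / 5] a magnetic
    geodesic; the second makes the integral of [a] over its lift vanish. *)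
Lemma exists_wedge_eq0 : strength (3 / 5) = 3 / 4 ->
  2 * (4 / 5 + potential (3 / 5)) = potential 1 + potential (- 1) ->
  exists2 p, Sigma p & forall u1 u2 u3, tangent Sigma p u1 ->
    tangent Sigma p u2 -> tangent Sigma p u3 ->
    wedge12 a (ext_d1 a) p u1 u2 u3 = 0.
Proof.
move=> hf hJ; pose s : R := acos (3 / 5).
have s35 : -1 <= (3 / 5 : R) <= 1 by apply/andP; split; lra.
have cs : cos s = 3 / 5 by rewrite acosK// in_itv.
have ss : sin s = 4 / 5.
  rewrite sin_acos//; have -> : 1 - (3 / 5) ^+ 2 = (4 / 5) ^+ 2 :> R by field.
  by rewrite sqrtr_sqr ger0_norm//; lra.
have int0 : axis_integral s = 0 by apply: axis_integral_eq0; rewrite ss cs.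
have [t at0] := Rintegral_eq0_root T_gt0 (@axis_integrand_continuous s) int0.
exists (axis_loop s t); first exact: axis_loop_in.
have aX : a (axis_loop s t)
    (magnetic_vector_field (fun x => strength (x 0 2)) (axis_loop s t)) = 0.
  (* The rotation moves the base point at speed [4 / 5], the radius, whereas the magnetic vector
     field has unit speed. *)
  have E : axis_loop_t s t = (4 / 5) *:
      magnetic_vector_field (fun x => strength (x 0 2)) (axis_loop s t).
    rewrite /magnetic_vector_field /axis_loop /axis_loop_t /= vec3E cs ss hf.
    have ht := sin2cos2 t.
    by congr pair; rewrite /=; apply: row3P; rewrite !coordE /=; field: ht.
  move: at0; rewrite E.
  have a0 := one_formN (axis_loop s t) 0.
  have := a_form.1 (axis_loop s t) (4 / 5)
    (magnetic_vector_field (fun x => strength (x 0 2)) (axis_loop s t)) 0.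
  rewrite oppr0 in a0; rewrite addr0 => ->.
  by move=> h; lra.
move=> u1 u2 u3; exact: (wedge_eq0 a_prim a_form (axis_loop_in s t) aX).
Qed.

End MagneticSystem.

Theorem proposition5p12 (R : realType) :
  exists (g s : 'rV[R]_3 -> 'rV[R]_3 -> 'rV[R]_3 -> R),
    symplectic_magnetic_system g s /\
    exists m : R, 0 < m /\ ~ contact_type g s m.
Proof.
(* With [k = 3 / 5] and radius [4 / 5], [b = 3 / 10 * d * c] is the condition
   [2 (4 / 5 + h(k)) = h(1) + h(-1)] once [4 / 5 = 16 / 15 * f(k)] is used, and
   the value of [c] normalises [f(k) = 3 / 4]. *)
pose k : R := 3 / 5.
(* Here [1 / 4] is [(h(1) + h(-1)) / c], as odd powers cancel, and the factor [3 / 10] of [b]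
   inverts [2 k + 32 / 15 = 10 / 3]. *)
pose d := 1 / 4 - 2 * (k ^+ 7 / 7 + k ^+ 8 / 8) - 32 / 15 * (k ^+ 6 + k ^+ 7).
pose c : R := 3 / 4 / (3 / 10 * d + (k ^+ 6 + k ^+ 7)).
pose b : R := 3 / 10 * d * c.
have k0 : 0 < k by rewrite divr_gt0.
(* This inequality dictates the high exponents: [d] is about 0.079, and its analogue for [z^4 + z^5]
   is negative. *)
have d0 : 0 < d.
  by rewrite /d /k; lra.
have den : 0 < 3 / 10 * d + (k ^+ 6 + k ^+ 7).
  have := exprn_gt0 6 k0; have := exprn_gt0 7 k0.
  by move: d0; clearbody d => d0 h1 h2; lra.
have c0 : 0 < c by rewrite divr_gt0// divr_gt0.
have b0 : 0 < b by rewrite !mulr_gt0// invr_gt0.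
exists (fun _ => @dot R), (field b c); split.
  by split; [exact: round_metric|exact: field_symplectic (ltW c0)].
exists 1; split=> // -[a [a_prim [a_form a_contact]]].
have hb : strength b c (3 / 5) = 3 / 4.
  rewrite /strength /b -/k.
  have -> : 3 / 10 * d * c + c * (k ^+ 6 + k ^+ 7) =
    c * (3 / 10 * d + (k ^+ 6 + k ^+ 7)) by ring.
  by rewrite divfK// gt_eqF.
have hJ : 2 * (4 / 5 + potential b c (3 / 5)) =
    potential b c 1 + potential b c (- 1).
  have : 16 / 15 * strength b c (3 / 5) = 4 / 5 by rewrite hb; lra.
  by rewrite /strength /potential /b /d /k; move: (c) => x h; lra.
have [p Sp w0] := exists_wedge_eq0 a_form a_prim hb hJ.
have [u1 [u2 [u3 [t1 t2 t3]]]] := a_contact p Sp.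
by rewrite w0 ?eqxx.
Qed.
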